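(* If $L$ is a $P_F$-frame, then $\downarrow\! a$ is a $P_F$-frame for each $a\in \mathrm{Coz}\,L$.
   Context: A frame is a complete lattice $L$ (top $1$, bottom $0$) satisfying $a\wedge\bigvee S=\bigvee\{a\wedge s\mid s\in S\}$ for all $a\in L$, $S\subseteq L$. For $a\in L$ the pseudocomplement is $a^*=\bigvee\{x\in L\mid x\wedge a=0\}$, and $a$ is complemented if $a\vee a^*=1$. Write $a\prec b$ if there is $t\in L$ with $a\wedge t=0$ and $t\vee b=1$; write $a\prec\!\prec b$ if there is a family $(c_q)$ indexed by $\mathbb{Q}\cap[0,1]$ with $c_0=a$, $c_1=b$ and $c_r\prec c_s$ whenever $r<s$. $L$ is completely regular if $a=\bigvee\{x\in L\mid x\prec\!\prec a\}$ for all $a\in L$. Throughout, all frames are assumed completely regular. An element $a\in L$ is a cozero element if there is a sequence $(a_n)$ with $a_n\prec\!\prec a$ for each $n$ and $a=\bigvee_n a_n$ (equivalently, $a=\mathrm{coz}\,\varphi$ for some real-valued continuous function $\varphi$ on $L$); $\mathrm{Coz}\,L$ is the set of cozero elements. $L$ is a $P_F$-frame if whenever $a,b\in\mathrm{Coz}\,L$ satisfy $a\wedge b=0$, at least one of $a,b$ is complemented. For $a\in L$, $\downarrow\! a=\{x\in L\mid x\le a\}$, a frame with bottom $0$ and top $a$. *)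

(* Defs.v *)
From HB Require Import structures.
From mathcomp Require Import all_boot all_order all_algebra.
From mathcomp Require Import boolp classical_sets.

Set Implicit Arguments.
Unset Strict Implicit.
Unset Printing Implicit Defensive.

Import Order.TTheory.
Local Open Scope order_scope.

HB.mixin Record TBLattice_isFrame d T of Order.TBLattice d T := {
  Sup : set T -> T;
  Sup_isLub : forall S : set T, isLub S (Sup S);
  meet_SupE : forall (a : T) (S : set T),
    a `&` Sup S = Sup [set (a `&` s)%O | s in S]%classic
}.

#[short(type="frameType")]
HB.structure Definition Frame d :=
  { T of Order.TBLattice d T & TBLattice_isFrame d T }.

Section FrameNotions.
Context {d : Order.disp_t} {L : frameType d}.
Implicit Types a b : L.

Definition pseudocompl a : L := Sup [set x | (x `&` a)%O = \bot]%classic.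

Definition complemented a : Prop := a `|` pseudocompl a = \top.

Definition rather_below a b : Prop :=
  exists t : L, a `&` t = \bot /\ t `|` b = \top.

(* Only the values of [c] on the rationals of [0, 1] are constrained, so [c]
   stands for an arbitrary family indexed by these rationals. *)
Definition completely_below a b : Prop :=
  exists c : rat -> L,
    [/\ c 0%R = a, c 1%R = b &
        forall r s : rat,
          (0 <= r)%R -> (r < s)%R -> (s <= 1)%R -> rather_below (c r) (c s)].

Definition cozero a : Prop :=
  exists u : nat -> L,
    (forall n, completely_below (u n) a) /\ a = Sup (range u).

End FrameNotions.

Definition completely_regular {d} (L : frameType d) : Prop :=
  forall a : L, a = Sup [set x | completely_below x a]%classic.

(* Complete regularity is part of the notion: to say that a frame is a
   P_F-frame is in particular to say that it is completely regular. *)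
Definition PF_frame {d} (L : frameType d) : Prop :=
  completely_regular L /\
  (forall a b : L, cozero a -> cozero b -> a `&` b = \bot ->
     complemented a \/ complemented b).

Section Downset.
Context {d : Order.disp_t} {L : frameType d} (a : L).

Record downset : Type := Downset { downset_val : L; downset_le : downset_val <= a }.

HB.instance Definition _ := [isSub for downset_val].
HB.instance Definition _ := [Choice of downset by <:].
HB.instance Definition _ := [SubChoice_isSubPOrder of downset by <: with d].

Let dmeet_le (x y : downset) : val x `&` val y <= a.
Proof. exact: leIxl (valP x). Qed.

Let djoin_le (x y : downset) : val x `|` val y <= a.
Proof. by rewrite leUx; apply/andP; split; [exact: (valP x) | exact: (valP y)]. Qed.

Let dmeet (x y : downset) : downset := Downset (dmeet_le x y).
Let djoin (x y : downset) : downset := Downset (djoin_le x y).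

Let dmeetP (x y z : downset) : (x <= dmeet y z) = (x <= y) && (x <= z).
Proof. by rewrite -!Order.le_val lexI. Qed.

Let djoinP (x y z : downset) : (djoin x y <= z) = (x <= z) && (y <= z).
Proof. by rewrite -!Order.le_val leUx. Qed.

HB.instance Definition _ :=
  Order.POrder_MeetJoin_isLattice.Build d downset dmeetP djoinP.

Let dbot : downset := Downset (le0x a).
Let dtop : downset := Downset (lexx a).

Let dbot_le (x : downset) : dbot <= x.
Proof. by rewrite -Order.le_val le0x. Qed.

Let dtop_ge (x : downset) : x <= dtop.
Proof. by rewrite -Order.le_val; exact: valP x. Qed.

HB.instance Definition _ := Order.hasBottom.Build d downset dbot_le.
HB.instance Definition _ := Order.hasTop.Build d downset dtop_ge.

Let dSup_le (S : set downset) : Sup [set val x | x in S]%classic <= a.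
Proof. by apply: (Sup_isLub _).2 => _ [x _ <-]; exact: valP x. Qed.

Let dSup (S : set downset) : downset := Downset (dSup_le S).

Let dSup_isLub (S : set downset) : isLub S (dSup S).
Proof.
split=> [x Sx|b bS]; rewrite -Order.le_val /=.
  by apply: (Sup_isLub _).1; exists x.
by apply: (Sup_isLub _).2 => _ [x Sx <-]; rewrite Order.le_val; exact: bS.
Qed.

Let dmeet_SupE (x : downset) (S : set downset) :
  x `&` dSup S = dSup [set (x `&` s)%O | s in S]%classic.
Proof.
apply: val_inj; rewrite /= meet_SupE; congr Sup.
by rewrite !image_comp.
Qed.

HB.instance Definition _ :=
  TBLattice_isFrame.Build d downset dSup_isLub dmeet_SupE.

End Downset.

(* Main.v *)
Require Import Defs.
From mathcomp Require Import all_boot all_order all_algebra.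
From mathcomp Require Import boolp classical_sets.

(** The point is that a cozero element [b] of [downset a] is already a cozero
    element of [L] when [a] is one ([cozero_downset]).  Write [a] as the join of
    elements [x n] completely below [a] in [L], and [b] as the join of elements
    [y m] completely below [b] in [downset a].  The meets [x n `&` y m] have
    join [a `&` b = b], and each of them is completely below [b] in [L]: the
    pointwise meet of the two interpolating families is again interpolating.
    For this, let [t] separate two stages [c r], [c s] of the first family in
    [L] and [u] separate two stages [e r], [e s] of the second in [downset a];
    then [t `|` u] separates the meets, since [u] and [e s] together only cover
    [a], but [t] covers the rest of [L] because [c s <= a]
    ([rather_below_downset_meet]).

    Hence disjoint cozero elements of [downset a] are disjoint cozero elements
    of [L], one of them is complemented in [L], and meeting its complement with
    [a] complements it in [downset a].  Complete regularity also descends to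
    [downset a], by meeting separating elements with [a]. *)

Set Implicit Arguments.
Unset Strict Implicit.
Unset Printing Implicit Defensive.

Import Order.TTheory.
Local Open Scope order_scope.

Section FrameFacts.
Context {d : Order.disp_t} {L : frameType d}.
Implicit Types (a b x y z : L) (S : set L).

Lemma le_Sup S x : S x -> x <= Sup S.
Proof. exact: (Sup_isLub S).1. Qed.

Lemma Sup_le S z : (forall x, S x -> x <= z) -> Sup S <= z.
Proof. exact: (Sup_isLub S).2. Qed.

(** The finite distributive law is the frame law for a two-element set. *)
Lemma frame_meetUr : right_distributive (@Order.meet d L) (@Order.join d L).
Proof.
move=> x y z; apply/le_anti/andP; split; last first.
  by rewrite leUx !leI2 ?leUl ?leUr.
have -> : y `|` z = Sup [set y; z]%classic.
  apply/le_anti/andP; split.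
    by rewrite leUx !le_Sup //=; [right|left].
  by apply: Sup_le => _ [] ->; rewrite ?leUl ?leUr.
rewrite meet_SupE; apply: Sup_le => _ [w [] -> <-]; first exact: leUl.
exact: leUr.
Qed.

Lemma frame_joinIr : right_distributive (@Order.join d L) (@Order.meet d L).
Proof.
move=> x y z.
have /meet_idPr xyx : x <= x `|` y by exact: leUl.
have /join_idPl xzx : z `&` x <= x by exact: leIr.
by rewrite frame_meetUr xyx [X in _ = _ `|` X]meetC frame_meetUr joinA xzx
  [z `&` y]meetC.
Qed.

Lemma rather_below_le x y : rather_below x y -> x <= y.
Proof.
case=> t [xt0 ty1]; have := meetx1 x.
by rewrite -ty1 frame_meetUr xt0 join0x => <-; exact: leIr.
Qed.

Lemma completely_below_le x y : completely_below x y -> x <= y.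
Proof. by case=> c [<- <- cP]; apply: rather_below_le; exact: cP. Qed.

Lemma interpolation_le_top (c : rat -> L) :
    (forall r s : rat, (0 <= r)%R -> (r < s)%R -> (s <= 1)%R ->
       rather_below (c r) (c s)) ->
  forall r : rat, (0 <= r)%R -> (r <= 1)%R -> c r <= c 1%R.
Proof.
move=> cP r r0; rewrite le_eqVlt => /orP[/eqP-> //|r1].
by apply: rather_below_le; exact: cP.
Qed.

End FrameFacts.

Section Downset.
Context {d : Order.disp_t} {L : frameType d} (a : L).
Implicit Types (b x y e : downset a).

Lemma rather_below_downset x y :
  rather_below (val x) (val y) -> rather_below x y.
Proof.
case=> t [xt0 ty1]; exists (Downset (leIr a t)); split; apply: val_inj => /=.
  by rewrite meetA xt0 meet0x.
have ya : val y <= a := valP y.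
by rewrite joinC frame_joinIr [_ `|` t]joinC ty1 meet1x; exact/join_idPr.
Qed.

Lemma completely_below_downset x y :
  completely_below (val x) (val y) -> completely_below x y.
Proof.
case=> c [c0 c1 cP].
have ca r : (0 <= r)%R -> (r <= 1)%R -> c r `&` a = c r.
  move=> r0 r1; apply/meet_idPl; apply: le_trans (valP y).
  by rewrite -c1; exact: interpolation_le_top.
exists (fun r => Downset (leIr a (c r))); split.
- by apply: val_inj; rewrite /= ca.
- by apply: val_inj; rewrite /= ca.
move=> r s r0 rs s1; apply: rather_below_downset => /=.
rewrite !ca //; [exact: cP | exact: le_trans r0 (ltW rs) |].
exact: le_trans (ltW rs) s1.
Qed.

Lemma completely_regular_downset :
  completely_regular L -> completely_regular (downset a).
Proof.
move=> crL y; apply/le_anti/andP; split; last first.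
  by apply: Sup_le => x; exact: completely_below_le.
rewrite -Order.le_val [leLHS](crL (val y)); apply: Sup_le => x xy.
have xa : x <= a := le_trans (completely_below_le xy) (valP y).
apply: le_Sup; exists (Downset xa) => //.
exact: completely_below_downset.
Qed.

(** The separating element [u] of the pair in [downset a] only gives
    [u `|` val e' = a].  Joining it with the separating element [t] of [p] and
    [q] repairs this: [t `|` a = \top] because [t `|` q = \top] and [q <= a]. *)
Lemma rather_below_downset_meet (p q : L) e e' :
    q <= a -> rather_below p q -> rather_below e e' ->
  rather_below (p `&` val e) (q `&` val e').
Proof.
move=> qa [t [pt0 tq1]] [u [/(congr1 val)/= eu0 /(congr1 val)/= ue'a]].
exists (t `|` val u); split.
  rewrite frame_meetUr -[X in _ `|` X]meetA eu0 meetx0 joinx0.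
  by rewrite meetAC pt0 meet0x.
have ta1 : t `|` a = \top.
  by apply/le_anti; rewrite lex1 -tq1 leU2.
by rewrite frame_joinIr joinAC tq1 join1x meet1x -joinA ue'a.
Qed.

Lemma completely_below_downset_meet (x : L) y b :
    completely_below x a -> completely_below y b ->
  completely_below (x `&` val y) (val b).
Proof.
case=> c [c0 c1 cP] [e [e0 e1 eP]].
exists (fun r => c r `&` val (e r)); split.
- by rewrite c0 e0.
- by rewrite c1 e1; apply/meet_idPr; exact: downset_le.
move=> r s r0 rs s1; apply: rather_below_downset_meet; [|exact: cP|exact: eP].
by rewrite -c1; apply: interpolation_le_top => //; exact: le_trans r0 (ltW rs).
Qed.

(** Countability of a join survives because [b = a `&` b] is the join of the
    doubly indexed family of meets of the two approximating sequences. *)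
Lemma cozero_downset b : cozero a -> cozero b -> cozero (val b).
Proof.
case=> u [ua aE] [v [vb bE]].
(* The doubly indexed family of meets is made a sequence by decoding pairs;
   every pair occurs, whatever the value chosen for non-codes. *)
pose ij k : nat * nat := odflt (0, 0)%N (unpickle k).
pose w k := u (ij k).1 `&` val (v (ij k).2).
have wb k : completely_below (w k) (val b).
  by apply: completely_below_downset_meet; [exact: ua | exact: vb].
exists w; split=> //; apply/le_anti/andP; split; last first.
  by apply: Sup_le => _ [k _ <-]; exact: completely_below_le (wb k).
rewrite [leLHS](congr1 val bE) /=; apply: Sup_le => _ [_ [m _ <-] <-].
have /meet_idPl <- : val (v m) <= a by exact: downset_le.
rewrite [X in _ `&` X]aE meet_SupE; apply: Sup_le => _ [_ [n _ <-] <-].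
apply: le_Sup; exists (pickle (n, m)) => //.
by rewrite /w /ij pickleK /= meetC.
Qed.

Lemma complemented_downset b : complemented (val b) -> complemented b.
Proof.
move=> bc; apply: val_inj; apply/le_anti/andP; split; first exact: downset_le.
rewrite /= -[leLHS]meetx1 -bc frame_meetUr; apply: leU2; first exact: leIr.
apply: le_Sup; exists (Downset (leIl a (pseudocompl (val b)))) => //=.
apply: val_inj; apply/le_anti; rewrite /= le0x andbT.
apply: (@le_trans _ _ (val b `&` pseudocompl (val b))).
  by rewrite meetC leI2 // leIr.
rewrite /pseudocompl meet_SupE; apply: Sup_le => _ [z zb0 <-].
by rewrite meetC zb0.
Qed.

End Downset.

Theorem proposition3p1 (d : Order.disp_t) (L : frameType d) :
  PF_frame L -> forall a : L, cozero a -> PF_frame (downset a).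
Proof.
move=> [crL PFL] a coza; split; first exact: completely_regular_downset.
move=> b c cozb cozc /(congr1 val)/= bc0.
have [bC|cC] := PFL _ _ (cozero_downset coza cozb) (cozero_downset coza cozc) bc0.
- by left; exact: complemented_downset.
- by right; exact: complemented_downset.
Qed.
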